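(* Let $k,m\in\mathbb{N}$ be fixed (positive integers) and let $\alpha_{k,m}$ be a real number with $0\le\alpha_{k,m}\le 1$. Suppose that for every $\varepsilon>0$ there exist constants $C_\varepsilon>0$ and $T_\varepsilon\ge 2$ such that $$\int_T^{2T}\left(\frac1G\int_{t-G}^{t+G}|\zeta(\tfrac12+iu)|^{2k}\,du\right)^m dt\;\le\; C_\varepsilon\, T^{1+\varepsilon}$$ for all $T\ge T_\varepsilon$ and all $G$ with $G\ge T^{\alpha_{k,m}}$ and $T^{\varepsilon}\le G\le T^{1-\varepsilon}$. Then for every $\varepsilon>0$ there exist constants $C'_\varepsilon>0$ and $T'_\varepsilon\ge2$ such that, for all $T\ge T'_\varepsilon$, all $G$ with $G\ge T^{\alpha_{k,m}}$ and $T^{\varepsilon}\le G\le T^{1-\varepsilon}$, all $R\in\mathbb{N}$ and all real points $T<t_1<t_2<\cdots<t_R<2T$ with $t_{r+1}-t_r\ge G$ for $r=1,\ldots,R-1$, $$\sum_{r=1}^R\int_{t_r-G}^{t_r+G}|\zeta(\tfrac12+it)|^{2k}\,dt\;\le\; C'_\varepsilon\,(RG)^{\frac{m-1}{m}}\,T^{\frac1m+\varepsilon}.$$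
   Context: $\zeta(s)$ denotes the Riemann zeta-function. The constants may depend on $k,m,\alpha_{k,m}$ and $\varepsilon$, but not on $T,G,R$ or the points $t_r$. *)

(* Defs.v *)
From Stdlib Require Import Reals.
From Coquelicot Require Import Coquelicot.
Local Open Scope R_scope.

Definition Cexp (z : C) : C :=
  (exp (fst z) * cos (snd z), exp (fst z) * sin (snd z)).

(* a ^ z for a real base a > 0, principal branch. *)
Definition Rcpow (a : R) (z : C) : C := Cexp (Cmult z (RtoC (ln a))).

(* Coquelicot has no zeta-function, so it is characterised as the analytic
   continuation of its Dirichlet series: by the identity theorem exactly one
   function on C \ {1} satisfies this predicate. The value at the pole s = 1
   is left unconstrained. Terms of the series are indexed from n = 0, hence
   the base n + 1. *)
Definition is_riemann_zeta (zeta : C -> C) : Prop :=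
  (forall s : C, 1 < fst s ->
     @is_series C_AbsRing C_NormedModule
       (fun n : nat => Rcpow (INR (S n)) (Copp s)) (zeta s)) /\
  (forall s : C, s <> RtoC 1 -> @ex_derive C_AbsRing C_NormedModule zeta s).

(* The integral of |zeta(1/2 + iu)|^(2k) over u in [t - G, t + G]. The
   integrand is continuous, since the critical line avoids the pole, so the
   total operator RInt is the genuine Riemann integral. *)
Definition zeta_moment (zeta : C -> C) (k : nat) (t G : R) : R :=
  RInt (fun u : R => Cmod (zeta (1 / 2, u)) ^ (2 * k)) (t - G) (t + G).

(* Main.v *)
Require Import Defs.
From Stdlib Require Import Reals Lra Lia.
From Coquelicot Require Import Coquelicot.
Local Open Scope R_scope.

(** Write [f u = |zeta(1/2 + iu)|^(2k)] and [W_H(t)] for the integral of [f]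
    over [[t - H, t + H]]. For every [s] in [[t_r - G, t_r]] the window of
    radius [2G] around [s] contains the window of radius [G] around [t_r]; as
    [f >= 0], averaging over [s] gives
    [W_G(t_r) <= (1/G) * int_(t_r - G)^(t_r) W_2G(s) ds]
    ([window_le_average_double]). The [t_r] are [G]-separated, so these
    [N] intervals of averaging do not overlap, have total length [N G], and lie
    in [[T/2, 2T]]. Hoelder's inequality with exponent [m] on their union
    ([separated_sum_holder]) then bounds the sum by
    [2 * (N G)^((m-1)/m) * (int_(T/2)^(2T) (W_2G / (2G))^m)^(1/m)],
    and the last integral is at most [O(T^(1 + eps/2))] by the moment
    hypothesis, used with [2G] and [eps/2] on the dyadic intervals that start
    at [T/2] and at [T].

    Placing the intervals to the left of the [t_r] means that the
    hypothesis is only needed at heights at most [T], where [2G] still exceeds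
    the [alpha]-th power of the height; replacing [eps] by [eps/2] leaves the
    room to double the window ([double_window_admissible]).

    Hoelder's inequality is obtained by integrating the tangent line bound
    [m l^(m-1) x <= x^m + (m-1) l^m] of the convex function [x^m] and then
    choosing the best [l]. *)

(** * Integrals of continuous functions *)

Lemma continuous_ex_RInt (f : R -> R) (a b : R) :
  (forall x, continuous f x) -> ex_RInt f a b.
Proof.
  intros Hf. apply (@ex_RInt_continuous R_CompleteNormedModule). auto.
Qed.

Lemma continuous_pow (f : R -> R) (n : nat) (x : R) :
  continuous f x -> continuous (fun y => f y ^ n) x.
Proof.
  intros Hf. induction n as [|n IH]; simpl.
  - apply continuous_const.
  - apply (@continuous_mult _ R_AbsRing f); assumption.
Qed.

Lemma RInt_const_R (c a b : R) : RInt (fun _ => c) a b = (b - a) * c.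
Proof. apply (RInt_const a b c). Qed.

Lemma RInt_Chasles_R (f : R -> R) (a b c : R) :
  (forall x, continuous f x) -> RInt f a c = RInt f a b + RInt f b c.
Proof.
  intros Hf. symmetry.
  apply (RInt_Chasles f a b c); apply continuous_ex_RInt; assumption.
Qed.

Lemma RInt_nonneg (f : R -> R) (a b : R) :
  (forall x, continuous f x) -> (forall x, 0 <= f x) -> a <= b ->
  0 <= RInt f a b.
Proof.
  intros Hf Hpos Hab. apply RInt_ge_0; auto using continuous_ex_RInt.
Qed.

Lemma RInt_mono_bounds (f : R -> R) (a b c d : R) :
  (forall x, continuous f x) -> (forall x, 0 <= f x) ->
  c <= a -> a <= b -> b <= d -> RInt f a b <= RInt f c d.
Proof.
  intros Hf Hpos Hca Hab Hbd.
  rewrite (RInt_Chasles_R f c a d), (RInt_Chasles_R f a b d) by assumption.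
  assert (H1 := RInt_nonneg f c a Hf Hpos Hca).
  assert (H2 := RInt_nonneg f b d Hf Hpos Hbd). lra.
Qed.

(** * Moving windows *)

Definition window (f : R -> R) (H t : R) : R := RInt f (t - H) (t + H).

Lemma window_nonneg (f : R -> R) (H t : R) :
  (forall x, continuous f x) -> (forall x, 0 <= f x) -> 0 <= H ->
  0 <= window f H t.
Proof. intros Hf Hpos HH. apply RInt_nonneg; auto; lra. Qed.

(** A window integral is a difference of two values of one primitive. *)
Lemma window_continuous (f : R -> R) (H t : R) :
  (forall x, continuous f x) -> continuous (window f H) t.
Proof.
  intros Hf.
  assert (HP : forall x, continuous (fun y => RInt f 0 y) x).
  { intros x. apply (@ex_derive_continuous R_AbsRing R_NormedModule). exists (f x).
    apply (is_derive_RInt f (fun y => RInt f 0 y) 0 x).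
    - apply filter_forall. intros y.
      apply (@RInt_correct R_CompleteNormedModule), continuous_ex_RInt, Hf.
    - apply Hf. }
  apply continuous_ext with (fun s => RInt f 0 (s + H) - RInt f 0 (s + - H)).
  { intros s. assert (E := RInt_Chasles_R f 0 (s - H) (s + H) Hf).
    unfold window, Rminus in *. symmetry. lra. }
  apply (@continuous_minus _ R_AbsRing R_NormedModule);
    apply (continuous_comp (fun s => s + _) (fun y => RInt f 0 y));
    try apply HP;
    apply (@continuous_plus _ R_AbsRing R_NormedModule);
    auto using continuous_id, continuous_const.
Qed.

(** For [s] between [t - G] and [t], the window of radius [2G] around [s]
    contains the window of radius [G] around [t]. The normalisation of the
    integrand is the one under which high moments are controlled; it costs the
    factor 2. *)
Lemma window_le_average_double (f : R -> R) (G t : R) :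
  (forall x, continuous f x) -> (forall x, 0 <= f x) -> 0 < G ->
  window f G t <= 2 * RInt (fun s => 1 / (2 * G) * window f (2 * G) s) (t - G) t.
Proof.
  intros Hf Hpos HG.
  replace (window f G t)
    with (2 * ((t - (t - G)) * (1 / (2 * G) * window f G t))) by (field; lra).
  rewrite <- RInt_const_R.
  apply Rmult_le_compat_l; [lra|].
  apply RInt_le; try lra.
  - apply continuous_ex_RInt. intros; apply continuous_const.
  - apply continuous_ex_RInt. intros.
    apply (@continuous_scal_r _ R_AbsRing R_NormedModule), window_continuous, Hf.
  - intros s Hs. apply Rmult_le_compat_l.
    + apply Rlt_le, Rdiv_lt_0_compat; lra.
    + apply RInt_mono_bounds; auto; lra.
Qed.

(** * Hoelder's inequality on separated intervals *)

Lemma pow_sub_mul_nonneg (x l : R) (n : nat) :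
  0 <= x -> 0 <= l -> 0 <= (x - l) * (x ^ n - l ^ n).
Proof.
  intros Hx Hl. destruct (Rle_dec l x) as [H|H].
  - assert (H' := pow_incr l x n (conj Hl H)). apply Rmult_le_pos; lra.
  - assert (H' := pow_incr x l n ltac:(lra)). nra.
Qed.

(** The graph of [x^(n+1)] lies above its tangent at [l]. In the inductive step
    the bound for [n], multiplied by [l], misses the next one exactly by
    [(x - l) (x^(n+1) - l^(n+1))]. *)
Lemma pow_tangent (n : nat) (x l : R) :
  0 <= x -> 0 <= l ->
  INR (S n) * l ^ n * x <= x ^ S n + INR n * l ^ S n.
Proof.
  intros Hx Hl. induction n as [|n IH].
  - simpl. lra.
  - assert (H := pow_sub_mul_nonneg x l (S n) Hx Hl).
    rewrite (S_INR (S n)). rewrite (S_INR n) in *.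
    assert (H' := Rmult_le_compat_l l _ _ Hl IH).
    simpl in *. nra.
Qed.

Lemma RInt_tangent (g : R -> R) (n : nat) (l a b : R) :
  (forall x, continuous g x) -> (forall x, 0 <= g x) -> 0 <= l -> a <= b ->
  INR (S n) * l ^ n * RInt g a b
    <= RInt (fun x => g x ^ S n) a b + INR n * l ^ S n * (b - a).
Proof.
  intros Hg Hpos Hl Hab.
  assert (Hgn : forall x, continuous (fun x : R => g x ^ S n) x)
    by (intros; apply continuous_pow, Hg).
  pose proof (RInt_scal g a b (INR (S n) * l ^ n)
    (continuous_ex_RInt g a b Hg)) as E1.
  pose proof (RInt_plus (fun x => g x ^ S n) (fun _ => INR n * l ^ S n) a b
    (continuous_ex_RInt _ a b Hgn) (ex_RInt_const _ _ _)) as E2.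
  rewrite RInt_const in E2.
  change (RInt (fun x => INR (S n) * l ^ n * g x) a b
            = INR (S n) * l ^ n * RInt g a b) in E1.
  change (RInt (fun x => g x ^ S n + INR n * l ^ S n) a b
            = RInt (fun x => g x ^ S n) a b + (b - a) * (INR n * l ^ S n)) in E2.
  rewrite <- E1, (Rmult_comm _ (b - a)), <- E2.
  apply RInt_le; auto.
  - apply continuous_ex_RInt. intros x.
    apply (@continuous_scal_r _ R_AbsRing R_NormedModule), Hg.
  - apply continuous_ex_RInt. intros x.
    apply (@continuous_plus _ R_AbsRing R_NormedModule);
      auto using continuous_const.
  - intros x _. apply pow_tangent; auto.
Qed.

(** The intervals [[t_r - G, t_r]] do not overlap, so the integrals of
    [g^(n+1)] over them add up to at most one integral, while the constant
    terms of the tangent bounds contribute in proportion to the total length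
    [N G]. *)
Lemma separated_sum_tangent (g : R -> R) (n : nat) (l a G : R) (t : nat -> R) (N : nat) :
  (forall x, continuous g x) -> (forall x, 0 <= g x) -> 0 <= l -> 0 <= G ->
  a <= t 1%nat - G ->
  (1 <= N)%nat ->
  (forall r, (1 <= r < N)%nat -> G <= t (S r) - t r) ->
  INR (S n) * l ^ n * sum_n_m (fun r => RInt g (t r - G) (t r)) 1 N
    <= RInt (fun x => g x ^ S n) a (t N) + INR n * l ^ S n * (INR N * G).
Proof.
  intros Hg Hpos Hl HG Ha HN.
  assert (Hgn : forall x, continuous (fun x : R => g x ^ S n) x)
    by (intros; apply continuous_pow, Hg).
  assert (Hgp : forall x, 0 <= g x ^ S n) by (intros; apply pow_le, Hpos).
  induction HN as [|N HN IH]; intros Hsep.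
  - rewrite sum_n_n.
    assert (H := RInt_tangent g n l (t 1%nat - G) (t 1%nat) Hg Hpos Hl ltac:(lra)).
    assert (H' := RInt_mono_bounds _ (t 1%nat - G) (t 1%nat) a (t 1%nat)
      Hgn Hgp ltac:(lra) ltac:(lra) ltac:(lra)).
    replace (t 1%nat - (t 1%nat - G)) with (INR 1 * G) in H by (simpl; ring).
    apply (Rle_trans _ _ _ H), Rplus_le_compat_r, H'.
  - rewrite sum_n_Sm by lia.
    change (plus (sum_n_m (fun r => RInt g (t r - G) (t r)) 1 N)
                 (RInt g (t (S N) - G) (t (S N))))
      with (sum_n_m (fun r => RInt g (t r - G) (t r)) 1 N
            + RInt g (t (S N) - G) (t (S N))).
    assert (Hgap := Hsep N ltac:(lia)).
    specialize (IH ltac:(intros r Hr; apply Hsep; lia)).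
    assert (H := RInt_tangent g n l (t (S N) - G) (t (S N)) Hg Hpos Hl ltac:(lra)).
    assert (H' := RInt_mono_bounds _ (t (S N) - G) (t (S N)) (t N) (t (S N))
      Hgn Hgp ltac:(lra) ltac:(lra) ltac:(lra)).
    rewrite (RInt_Chasles_R (fun x : R => g x ^ S n) a (t N) (t (S N)) Hgn).
    rewrite (S_INR N).
    replace (t (S N) - (t (S N) - G)) with G in H by ring.
    rewrite Rmult_plus_distr_l.
    replace (INR n * l ^ S n * ((INR N + 1) * G))
      with (INR n * l ^ S n * (INR N * G) + INR n * l ^ S n * G) by ring.
    lra.
Qed.

Lemma Rpower_pow_root (x : R) (n : nat) :
  0 < x -> Rpower x (/ INR (S n)) ^ S n = x.
Proof.
  intros Hx. rewrite <- Rpower_pow by apply exp_pos.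
  rewrite Rpower_mult, Rinv_l by (apply not_0_INR; lia).
  apply Rpower_1, Hx.
Qed.

(** For a single interval of length [L], with [X] and [J] the integrals of [g]
    and [g^(n+1)], the hypothesis is [RInt_tangent]; optimising over the point
    of tangency turns the linear bounds into Hoelder's inequality. *)
Lemma holder_from_tangents (n : nat) (X J L : R) :
  0 < J -> 0 < L ->
  (forall l, 0 < l ->
     INR (S n) * l ^ n * X <= J + INR n * l ^ S n * L) ->
  X <= Rpower L (INR n / INR (S n)) * Rpower J (1 / INR (S n)).
Proof.
  intros HJ HL Htan.
  set (p := INR (S n)).
  assert (Hp : 0 < p) by (apply lt_0_INR; lia).
  assert (Ep : p = INR n + 1) by apply S_INR.
  assert (HJL : 0 < J / L) by (apply Rdiv_lt_0_compat; assumption).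
  (* The right-hand side over [l^n] is least when [l^(n+1) L = J]. *)
  pose (l := Rpower (J / L) (/ p)).
  assert (Hl : 0 < l) by apply exp_pos.
  assert (Eln : l ^ S n = J / L) by (apply Rpower_pow_root; assumption).
  specialize (Htan l Hl). fold p in Htan.
  assert (Hln : 0 < l ^ n) by (apply pow_lt; assumption).
  assert (Hb : l ^ n * X <= J).
  { apply Rmult_le_reg_l with p; [assumption|].
    rewrite Eln in Htan.
    replace (INR n * (J / L) * L) with (INR n * J) in Htan by (field; lra).
    rewrite Ep in *. lra. }
  assert (Eopt : l ^ n * (Rpower L (INR n / p) * Rpower J (1 / p)) = J).
  { unfold l. rewrite <- Rpower_pow by apply exp_pos.
    rewrite Rpower_mult. unfold Rpower. rewrite <- !exp_plus.
    rewrite ln_div by assumption.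
    replace (/ p * INR n * (ln J - ln L) + (INR n / p * ln L + 1 / p * ln J))
      with (ln J) by (rewrite Ep; field; rewrite <- Ep; lra).
    apply exp_ln, HJ. }
  apply Rmult_le_reg_l with (l ^ n); [assumption|]. lra.
Qed.

Lemma separated_sum_holder (g : R -> R) (n : nat) (a G J : R) (t : nat -> R) (N : nat) :
  (forall x, continuous g x) -> (forall x, 0 <= g x) -> 0 < G -> 0 < J ->
  a <= t 1%nat - G ->
  (1 <= N)%nat ->
  (forall r, (1 <= r < N)%nat -> G <= t (S r) - t r) ->
  RInt (fun x : R => g x ^ S n) a (t N) <= J ->
  sum_n_m (fun r => RInt g (t r - G) (t r)) 1 N
    <= Rpower (INR N * G) (INR n / INR (S n)) * Rpower J (1 / INR (S n)).
Proof.
  intros Hg Hpos HG HJ0 Ha HN Hsep HJ.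
  apply holder_from_tangents; [assumption| |].
  - apply Rmult_lt_0_compat; [apply lt_0_INR; lia|assumption].
  - intros l Hl.
    assert (H := separated_sum_tangent g n l a G t N Hg Hpos
      ltac:(lra) ltac:(lra) Ha HN Hsep).
    apply (Rle_trans _ _ _ H), Rplus_le_compat_r, HJ.
Qed.

(** * The zeta-function on the critical line *)

(** Complex differentiability is taken in the topology given by the modulus,
    so [u |-> 1/2 + iu] has to be seen as an isometry for the modulus. *)
Lemma zeta_integrand_continuous (zeta : C -> C) (k : nat) :
  is_riemann_zeta zeta ->
  forall u : R, continuous (fun u : R => Cmod (zeta (1 / 2, u)) ^ (2 * k)) u.
Proof.
  intros [_ Hd] u. apply continuous_pow.
  assert (Hc := ex_derive_continuous _ _ (Hd (1 / 2, u) ltac:(intros [=]; lra))).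
  apply (filterlim_comp _ _ _ (fun u => zeta (1 / 2, u)) Cmod _
           (@locally (NormedModule.UniformSpace C_AbsRing C_NormedModule) (zeta (1/2, u)))).
  2: apply (@filterlim_norm C_AbsRing C_NormedModule).
  refine (filterlim_comp _ _ _ (fun u => (1 / 2, u) : C) zeta _ _ _ _ Hc).
  apply (filterlim_locally (U := AbsRing_UniformSpace C_AbsRing)).
  intros e. exists e. intros v Hv.
  change (Cmod (Cminus (1 / 2, v) (1 / 2, u)) < e).
  replace (Cminus (1 / 2, v) (1 / 2, u)) with (Cmult Ci (RtoC (v - u))).
  - rewrite Cmod_mult, Cmod_R.
    replace (Cmod Ci) with 1.
    + rewrite Rmult_1_l. exact Hv.
    + unfold Cmod, Ci; simpl. rewrite <- sqrt_1 at 1. f_equal. ring.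
  - unfold Cmult, Cminus, Cplus, Copp, Ci, RtoC; simpl. f_equal; ring.
Qed.

(** Halving [T] and doubling [G] lose a factor of at most 4 in all, and
    [T^(eps/2) >= 4] makes up for it. *)
Lemma double_window_admissible (T G eps : R) :
  0 < eps -> 2 <= T -> Rpower 4 (2 / eps) <= T ->
  Rpower T eps <= G <= Rpower T (1 - eps) ->
  2 * G <= Rpower (T / 2) (1 - eps / 2).
Proof.
  intros He HT HT4 [Hlo Hhi].
  assert (HT0 : 0 < T) by lra.
  assert (H4 : 4 <= Rpower T (eps / 2)).
  { replace 4 with (Rpower (Rpower 4 (2 / eps)) (eps / 2)).
    - apply Rle_Rpower_l; [lra|]. split; [apply exp_pos|assumption].
    - rewrite Rpower_mult. replace (2 / eps * (eps / 2)) with 1 by (field; lra).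
      apply Rpower_1. lra. }
  assert (Hsplit : Rpower T (1 - eps / 2) = Rpower T (1 - eps) * Rpower T (eps / 2)).
  { rewrite <- Rpower_plus. f_equal. field. }
  assert (Hhalf : Rpower T (1 - eps / 2)
            = Rpower (T / 2) (1 - eps / 2) * Rpower 2 (1 - eps / 2)).
  { rewrite Rpower_mult_distr by lra. f_equal. field. }
  assert (H2 : Rpower 2 (1 - eps / 2) <= 2).
  { apply Rle_trans with (Rpower 2 1); [apply Rle_Rpower|rewrite Rpower_1]; lra. }
  assert (Hp1 : 0 < Rpower (T / 2) (1 - eps / 2)) by apply exp_pos.
  assert (Hp2 : 0 < Rpower T (1 - eps)) by apply exp_pos.
  nra.
Qed.

Theorem theorem1 (zeta : C -> C) (Hzeta : is_riemann_zeta zeta)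
  (k m : nat) (Hk : (1 <= k)%nat) (Hm : (1 <= m)%nat)
  (alpha : R) (Halpha : 0 <= alpha <= 1)
  (Hmoment : forall eps : R, 0 < eps ->
     exists C0 T0 : R, 0 < C0 /\ 2 <= T0 /\
     forall T G : R, T0 <= T ->
       Rpower T alpha <= G ->
       Rpower T eps <= G <= Rpower T (1 - eps) ->
       RInt (fun t : R => (1 / G * zeta_moment zeta k t G) ^ m) T (2 * T)
         <= C0 * Rpower T (1 + eps)) :
  forall eps : R, 0 < eps ->
    exists C1 T1 : R, 0 < C1 /\ 2 <= T1 /\
    forall T G : R, T1 <= T ->
      Rpower T alpha <= G ->
      Rpower T eps <= G <= Rpower T (1 - eps) ->
      forall (N : nat) (t : nat -> R),
        (1 <= N)%nat ->
        T < t 1%nat ->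
        (forall r : nat, (1 <= r < N)%nat -> t r < t (S r)) ->
        t N < 2 * T ->
        (forall r : nat, (1 <= r < N)%nat -> G <= t (S r) - t r) ->
        sum_n_m (fun r : nat => zeta_moment zeta k (t r) G) 1 N
          <= C1 * Rpower (INR N * G) ((INR m - 1) / INR m)
                * Rpower T (1 / INR m + eps).
Proof.
  intros eps Heps.
  destruct m as [|n]; [lia|].
  destruct (Hmoment (eps / 2) ltac:(lra)) as (C0 & T0 & HC0 & HT0 & Hmom).
  set (p := INR (S n)).
  assert (Hp : 1 <= p) by (apply (le_INR 1); lia).
  exists (2 * Rpower (2 * C0) (1 / p)), (Rmax (2 * T0) (Rpower 4 (2 / eps))).
  split; [apply Rmult_lt_0_compat; [lra|apply exp_pos]|].
  split; [apply Rle_trans with (2 * T0); [lra|apply Rmax_l]|].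
  intros T G HT Halp HG N t HN Ht1 _ HtN Hsep.
  assert (HT1 : 2 * T0 <= T) by (eapply Rle_trans; [apply Rmax_l|eassumption]).
  assert (HT4 : Rpower 4 (2 / eps) <= T)
    by (eapply Rle_trans; [apply Rmax_r|eassumption]).
  assert (HG0 : 0 < G) by (eapply Rlt_le_trans; [apply exp_pos|apply HG]).
  assert (H2G := double_window_admissible T G eps Heps ltac:(lra) HT4 HG).
  assert (HGT : 2 * G <= T / 2).
  { apply (Rle_trans _ _ _ H2G). rewrite <- (Rpower_1 (T / 2)) at 2 by lra.
    apply Rle_Rpower; lra. }
  set (f := fun u : R => Cmod (zeta (1 / 2, u)) ^ (2 * k)).
  assert (Hf : forall x, continuous f x) by (apply zeta_integrand_continuous, Hzeta).
  assert (Hfpos : forall x, 0 <= f x) by (intros; apply pow_le, Cmod_ge_0).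
  set (g := fun s : R => 1 / (2 * G) * window f (2 * G) s).
  assert (Hg : forall x, continuous g x).
  { intros x. apply (@continuous_scal_r _ R_AbsRing R_NormedModule).
    apply window_continuous, Hf. }
  assert (Hgpos : forall x, 0 <= g x).
  { intros x. apply Rmult_le_pos.
    - apply Rlt_le, Rdiv_lt_0_compat; lra.
    - apply window_nonneg; auto; lra. }
  assert (Hgn : forall x, continuous (fun x : R => g x ^ S n) x)
    by (intros; apply continuous_pow, Hg).
  assert (Hgnpos : forall x, 0 <= g x ^ S n) by (intros; apply pow_le, Hgpos).
  assert (Hdyadic : forall T', T / 2 <= T' <= T ->
    RInt (fun x : R => g x ^ S n) T' (2 * T') <= C0 * Rpower T (1 + eps / 2)).
  { intros T' HT'. eapply Rle_trans; [apply (Hmom T' (2 * G))|].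
    - lra.
    - apply Rle_trans with (Rpower T alpha); [|lra].
      apply Rle_Rpower_l; lra.
    - split.
      + apply Rle_trans with (Rpower T (eps / 2)); [apply Rle_Rpower_l; lra|].
        apply Rle_trans with (Rpower T eps); [apply Rle_Rpower; lra|lra].
      + apply (Rle_trans _ _ _ H2G). apply Rle_Rpower_l; [|lra].
        (* A nonempty range of [G] forces [eps <= 1/2], so [1 - eps/2 >= 0]. *)
        assert (eps <= 1 - eps); [|lra].
        apply Rnot_lt_le. intros Hlt.
        assert (Rpower T (1 - eps) < Rpower T eps) by (apply Rpower_lt; lra).
        lra.
    - apply Rmult_le_compat_l; [lra|]. apply Rle_Rpower_l; lra. }
  set (J := 2 * C0 * Rpower T (1 + eps / 2)).
  assert (HTpos : 0 < Rpower T (1 + eps / 2)) by apply exp_pos.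
  assert (HJ : RInt (fun x : R => g x ^ S n) (T / 2) (2 * T) <= J).
  { rewrite (RInt_Chasles_R _ (T / 2) T (2 * T) Hgn).
    assert (H1 := Hdyadic (T / 2) ltac:(lra)).
    assert (H2 := Hdyadic T ltac:(lra)).
    replace (2 * (T / 2)) with T in H1 by field.
    unfold J. lra. }
  assert (HJ0 : 0 < J) by (unfold J; apply Rmult_lt_0_compat; lra).
  set (Sg := sum_n_m (fun r => RInt g (t r - G) (t r)) 1 N).
  assert (HSg : Sg <= Rpower (INR N * G) (INR n / p) * Rpower J (1 / p)).
  { apply (separated_sum_holder g n (T / 2)); try assumption; try lra.
    assert (HtN2 : T <= t N).
    { clear HtN Sg. induction HN as [|N HN IH]; [lra|].
      assert (G <= t (S N) - t N) by (apply Hsep; lia).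
      specialize (IH ltac:(intros r Hr; apply Hsep; lia)). lra. }
    refine (Rle_trans _ _ _ _ HJ).
    apply (RInt_mono_bounds _ _ _ _ _ Hgn Hgnpos); lra. }
  apply Rle_trans with (2 * Sg).
  { unfold Sg. rewrite <- (sum_n_m_mult_l (K := R_AbsRing) 2).
    apply sum_n_m_le. intros r. apply window_le_average_double; assumption. }
  assert (HJp : Rpower J (1 / p)
            <= Rpower (2 * C0) (1 / p) * Rpower T (1 / p + eps)).
  { unfold J. rewrite <- Rpower_mult_distr by (try assumption; lra).
    apply Rmult_le_compat_l; [apply Rlt_le, exp_pos|].
    rewrite Rpower_mult. apply Rle_Rpower; [lra|].
    assert (/ p <= 1) by (rewrite <- Rinv_1; apply Rinv_le_contravar; lra).
    assert (0 < / p) by (apply Rinv_0_lt_compat; lra).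
    unfold Rdiv. nra. }
  replace (p - 1) with (INR n) by (unfold p; rewrite S_INR; ring).
  assert (HLp : 0 < Rpower (INR N * G) (INR n / p)) by apply exp_pos.
  assert (H := Rmult_le_compat_l _ _ _ (Rlt_le _ _ HLp) HJp).
  lra.
Qed.
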